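(* Let $R$ be an associative ring with $1$, let $\Gamma$ be a descending chain $\varphi_0\ge\varphi_1\ge\varphi_2\ge\cdots$ of pp formulas of the same fixed arity in the language of left $R$-modules. For each $i$ let $(A_i,\bar a_i)$ be a free realization of $\varphi_i$ with $A_i$ finitely presented, let $g_i:A_i\to A_{i+1}$ be homomorphisms with $g_i(\bar a_i)=\bar a_{i+1}$, let $B_\Gamma$ be the direct limit of $A_0\xrightarrow{g_0}A_1\xrightarrow{g_1}A_2\to\cdots$, and let $F_\Gamma=\bigoplus_i A_i^{(\omega)}$. Then: (1) the (pure-projective) module $F_\Gamma$ is elementarily equivalent to $F_\Gamma\oplus B_\Gamma$; (2) if $\Gamma$ does not stabilize, then $B_\Gamma$ is not Mittag-Leffler, hence not pure-projective.
   Context: Modules are unitary left $R$-modules. A pp formula is an existentially quantified finite conjunction of $R$-linear equations. For pp formulas of the same arity, $\varphi\le\psi$ means $\varphi(N)\subseteq\psi(N)$ for every left $R$-module $N$. A free realization of a pp formula $\varphi(\bar x)$ is a pair $(A,\bar a)$ with $A$ a finitely presented module and $\bar a\in\varphi(A)$ such that for every module $N$ and $\bar b\in\varphi(N)$ there is a homomorphism $A\to N$ with $\bar a\mapsto\bar b$. (Free realizations always exist, and homomorphisms $g_i$ as in the claim exist because $\bar a_{i+1}$ satisfies $\varphi_i$ in $A_{i+1}$.) $\Gamma$ stabilizes if there is $i$ such that $\varphi_i\le\varphi_j$ for all $j\ge i$. $A^{(\omega)}$ is the direct sum of countably infinitely many copies of $A$. A module is pure-projective if it is a direct summand of a direct sum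 of finitely presented modules. A module $M$ is Mittag-Leffler if every finite tuple $\bar a$ in $M$ has finitely generated pp type, i.e. there is a pp formula $\varphi(\bar x)$ satisfied by $\bar a$ in $M$ such that $\varphi\le\psi$ for every pp formula $\psi(\bar x)$ that $\bar a$ satisfies in $M$. *)

(* Defs.v *)
From HB Require Import structures.
From mathcomp Require Import all_boot all_order all_algebra.
From mathcomp Require Import mathcomp_extra boolp classical_sets functions.
From mathcomp Require Import cardinality.

Set Implicit Arguments.
Unset Strict Implicit.
Unset Printing Implicit Defensive.

Import GRing.Theory.
Local Open Scope classical_set_scope.
Local Open Scope ring_scope.

(* Associative unital rings are [pzRingType]s (the zero ring is allowed) and
   unitary left R-modules are [lmodType R]s. *)

Definition dprod (R : pzRingType) (I : Type) (M : I -> lmodType R) : Type :=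
  forall i, M i.

Section DirectProduct.
Variables (R : pzRingType) (I : Type) (M : I -> lmodType R).
Implicit Types f g h : dprod M.

HB.instance Definition _ := gen_eqMixin (dprod M).
HB.instance Definition _ := gen_choiceMixin (dprod M).

Let dp0 : dprod M := fun=> 0.
Let dpN f : dprod M := fun i => - f i.
Let dpD f g : dprod M := fun i => f i + g i.
Let dpZ (r : R) f : dprod M := fun i => r *: f i.

Let dpDA : associative dpD.
Proof. by move=> f g h; apply: functional_extensionality_dep => i;
   rewrite /dpD addrA. Qed.
Let dpDC : commutative dpD.
Proof. by move=> f g; apply: functional_extensionality_dep => i;
   rewrite /dpD addrC. Qed.
Let dp0D : left_id dp0 dpD.
Proof. by move=> f; apply: functional_extensionality_dep => i;
   rewrite /dpD add0r. Qed.
Let dpND : left_inverse dp0 dpN dpD.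
Proof. by move=> f; apply: functional_extensionality_dep => i;
   rewrite /dpD addNr. Qed.

HB.instance Definition _ :=
  GRing.isZmodule.Build (dprod M) dpDA dpDC dp0D dpND.

Let dpZA r s f : dpZ r (dpZ s f) = dpZ (r * s) f.
Proof. by apply: functional_extensionality_dep => i;
   rewrite /dpZ scalerA. Qed.
Let dp1Z : left_id 1 dpZ.
Proof. by move=> f; apply: functional_extensionality_dep => i;
   rewrite /dpZ scale1r. Qed.
Let dpZDr : right_distributive dpZ +%R.
Proof. by move=> r f g; apply: functional_extensionality_dep => i;
   rewrite /dpZ scalerDr. Qed.
Let dpZDl f : {morph dpZ^~ f : r s / r + s}.
Proof. by move=> r s; apply: functional_extensionality_dep => i;
   rewrite /dpZ scalerDl. Qed.

HB.instance Definition _ :=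
  GRing.Zmodule_isLmodule.Build R (dprod M) dpZA dp1Z dpZDr dpZDl.

Definition finsupp : pred (dprod M) :=
  fun f => `[< finite_set [set i | f i <> 0] >].

Fact finsupp_submod_closed : submod_closed finsupp.
Proof.
split=> [|r f g /asboolP fF /asboolP gF]; apply/asboolP.
  by apply: (sub_finite_set _ (finite_set0 I)) => i /=; apply.
apply: (@sub_finite_set _ _ ([set i | f i <> 0] `|` [set i | g i <> 0])).
  move=> i /= fgi; have [fi0|] := pselect (f i = 0); last by left.
  right=> gi0; apply: fgi.
  have -> : (r *: f + g) i = r *: f i + g i by [].
  by rewrite fi0 gi0 scaler0 addr0.
by rewrite finite_setU.
Qed.

Record dsum : Type := DSum { dsum_val :> dprod M; _ : dsum_val \in finsupp }.

HB.instance Definition _ := [isSub for dsum_val].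
HB.instance Definition _ := [Choice of dsum by <:].
HB.instance Definition _ :=
  GRing.SubChoice_isSubLmodule.Build R (dprod M) finsupp dsum
    (GRing.submod_closed_semi finsupp_submod_closed).

End DirectProduct.

Definition dsum_omega (R : pzRingType) (A : lmodType R) : lmodType R :=
  dsum (fun _ : nat => A).

Section FirstOrder.
Variable R : pzRingType.

(* Terms and formulas are well scoped: the free variables of an element of
   [fo n] are indexed by 'I_n, and each quantifier binds the variable [ord0]
   of its body. *)
Inductive mterm (n : nat) : Type :=
  | MVar of 'I_n
  | MZero
  | MAdd of mterm n & mterm n
  | MOpp of mterm n
  | MScale of R & mterm n.

Inductive fo : nat -> Type :=
  | FEq n of mterm n & mterm n : fo n
  | FNot n of fo n : fo n
  | FAnd n of fo n & fo n : fo n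
  | FOr n of fo n & fo n : fo n
  | FImp n of fo n & fo n : fo n
  | FAll n of fo n.+1 : fo n
  | FEx n of fo n.+1 : fo n.

Variable M : lmodType R.

Definition vcons n (x : M) (v : 'I_n -> M) : 'I_n.+1 -> M :=
  fun i => if unlift ord0 i is Some j then v j else x.

Fixpoint mterm_eval n (v : 'I_n -> M) (t : mterm n) : M :=
  match t with
  | MVar i => v i
  | MZero => 0
  | MAdd t u => mterm_eval v t + mterm_eval v u
  | MOpp t => - mterm_eval v t
  | MScale r t => r *: mterm_eval v t
  end.

Fixpoint fo_sat n (s : fo n) : ('I_n -> M) -> Prop :=
  match s in fo n return ('I_n -> M) -> Prop with
  | FEq _ t u => fun v => mterm_eval v t = mterm_eval v u
  | FNot _ s1 => fun v => ~ fo_sat s1 v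
  | FAnd _ s1 s2 => fun v => fo_sat s1 v /\ fo_sat s2 v
  | FOr _ s1 s2 => fun v => fo_sat s1 v \/ fo_sat s2 v
  | FImp _ s1 s2 => fun v => fo_sat s1 v -> fo_sat s2 v
  | FAll _ s1 => fun v => forall x, fo_sat s1 (vcons x v)
  | FEx _ s1 => fun v => exists x, fo_sat s1 (vcons x v)
  end.

Definition models (s : fo 0) : Prop := forall v : 'I_0 -> M, fo_sat s v.

End FirstOrder.

Definition elem_equiv (R : pzRingType) (M N : lmodType R) : Prop :=
  forall s : fo R 0, models M s <-> models N s.

Section PP.
Variable R : pzRingType.

(* [PP C D] stands for the formula in x_0, ..., x_(n-1)
     exists y_0 ... y_(m-1), /\_(e < k) \sum_j C e j x_j + \sum_l D e l y_l = 0
   where m = pp_bound and k = pp_eqs. *)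
Record pp (n : nat) : Type := PP {
  pp_bound : nat;
  pp_eqs : nat;
  pp_free_coef : 'M[R]_(pp_eqs, n);
  pp_bound_coef : 'M[R]_(pp_eqs, pp_bound) }.

Definition pp_sat n (phi : pp n) (N : lmodType R) (x : 'I_n -> N) : Prop :=
  exists y : 'I_(pp_bound phi) -> N, forall e : 'I_(pp_eqs phi),
    \sum_(j < n) pp_free_coef phi e j *: x j
      + \sum_(l < pp_bound phi) pp_bound_coef phi e l *: y l = 0.

Definition pp_le n (phi psi : pp n) : Prop :=
  forall (N : lmodType R) (x : 'I_n -> N), pp_sat phi x -> pp_sat psi x.

Definition descending n (phi : nat -> pp n) : Prop :=
  forall i, pp_le (phi i.+1) (phi i).

Definition stabilizes n (phi : nat -> pp n) : Prop :=
  exists i, forall j, (i <= j)%N -> pp_le (phi i) (phi j).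

(* A has a presentation R^m --K--> R^n --f--> A --> 0, with row vectors, so
   that left scalars act on R^n and K acts by multiplication on the right. *)
Definition fin_pres (A : lmodType R) : Prop :=
  exists (m n : nat) (K : 'M[R]_(m, n)) (f : {linear 'rV[R]_n -> A}),
    (forall z, exists v, f v = z) /\
    (forall v, f v = 0 <-> exists c : 'rV[R]_m, v = c *m K).

Definition free_realization n (phi : pp n) (A : lmodType R) (a : 'I_n -> A)
  : Prop :=
  [/\ fin_pres A, pp_sat phi a &
    forall (N : lmodType R) (b : 'I_n -> N), pp_sat phi b ->
      exists h : {linear A -> N}, forall j, h (a j) = b j].

Definition pure_projective (M : lmodType R) : Prop :=
  exists (I : Type) (C : I -> lmodType R) (M' : lmodType R)
         (f : {linear (M * M')%type -> dsum C}),
    (forall i, fin_pres (C i)) /\ bijective f.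

Definition mittag_leffler (M : lmodType R) : Prop :=
  forall (n : nat) (a : 'I_n -> M),
    exists2 phi : pp n, pp_sat phi a &
      forall psi : pp n, pp_sat psi a -> pp_le phi psi.

Section DirectLimit.
Variables (A : nat -> lmodType R) (g : forall i, {linear A i -> A i.+1}).

Definition cocone (N : lmodType R) (k : forall i, {linear A i -> N}) : Prop :=
  forall i (x : A i), k i.+1 (g i x) = k i x.

Definition direct_limit (B : lmodType R) (h : forall i, {linear A i -> B})
  : Prop :=
  cocone h /\
  forall (N : lmodType R) (k : forall i, {linear A i -> N}), cocone k ->
    exists2 u : {linear B -> N}, (forall i x, u (h i x) = k i x) &
      forall u' : {linear B -> N}, (forall i x, u' (h i x) = k i x) -> u' =1 u.

End DirectLimit.

End PP.

(* Main.v *)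
Require Import Defs.
From HB Require Import structures.
From mathcomp Require Import all_boot all_order all_algebra.
From mathcomp Require Import generic_quotient ring_quotient.
From mathcomp Require Import boolp classical_sets cardinality.

(* (1) Call a module M fresh if every inclusion phi <= psi of pp formulas that
   holds in all the A_i holds in M, and if every A_i has, for each finite tuple
   of M, a copy that is a direct summand of M whose projection kills the tuple.
   Fresh modules are elementarily equivalent, because modulo fresh modules each
   formula is controlled by finitely many pp formulas. In the step for an
   existential quantifier one needs a solution of a pp formula theta avoiding
   finitely many psi; when theta is not contained in psi at the zero parameters,
   adding to a given solution an element of a fresh copy of some A_i that lies
   in theta but not in psi does it (this replaces the appeal to Neumann's
   lemma). F is fresh because of the infinitely many copies, and so is F * B
   because a solution of a pp formula in a direct limit comes from some A_i.

   (2) If the pp type of the image b of the a_i in B were generated by theta,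
   then theta would hold of a_i for some i, so phi_i <= theta; as b satisfies
   all the phi_j, also theta <= phi_j, and the chain would stabilize at i.
   Direct sums of finitely presented modules, and direct summands of
   Mittag-Leffler modules, are Mittag-Leffler. *)

Set Implicit Arguments.
Unset Strict Implicit.
Unset Printing Implicit Defensive.

Import GRing.Theory.
Local Open Scope ring_scope.

(** * Operations on pp formulas *)

Section PPClosure.
Variables (R : pzRingType) (n : nat) (phi : pp R n).

Lemma pp_sat_eq (M : lmodType R) (x x' : 'I_n -> M) :
  x =1 x' -> pp_sat phi x -> pp_sat phi x'.
Proof. by move=> /funext ->. Qed.

Lemma pp_sat_lin (M N : lmodType R) (f : {linear M -> N}) (x : 'I_n -> M) :
  pp_sat phi x -> pp_sat phi (f \o x).
Proof.
case=> y xy; exists (f \o y) => e; rewrite -[RHS](raddf0 f) -(xy e) raddfD.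
rewrite !raddf_sum.
by congr (_ + _); apply: eq_bigr => j _; exact: esym (linearZ_LR f _ _).
Qed.

Lemma pp_sat0 (M : lmodType R) : pp_sat phi (fun=> 0 : M).
Proof.
exists (fun=> 0) => e.
by rewrite !big1 ?addr0 // => j _; rewrite scaler0.
Qed.

Lemma pp_satD (M : lmodType R) (x x' : 'I_n -> M) :
  pp_sat phi x -> pp_sat phi x' -> pp_sat phi (fun j => x j + x' j).
Proof.
case=> y xy [y' xy']; exists (fun l => y l + y' l) => e.
under eq_bigr do rewrite scalerDr.
under [X in _ + X]eq_bigr do rewrite scalerDr.
by rewrite !big_split /= addrACA xy xy' addr0.
Qed.

Lemma pp_satN (M : lmodType R) (x : 'I_n -> M) :
  pp_sat phi x -> pp_sat phi (fun j => - x j).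
Proof.
case=> y xy; exists (fun l => - y l) => e.
under eq_bigr do rewrite scalerN.
under [X in _ + X]eq_bigr do rewrite scalerN.
by rewrite !sumrN -opprD xy oppr0.
Qed.

Lemma pp_satB (M : lmodType R) (x x' : 'I_n -> M) :
  pp_sat phi x -> pp_sat phi x' -> pp_sat phi (fun j => x j - x' j).
Proof. by move=> px /pp_satN; apply: pp_satD. Qed.

End PPClosure.

(** * Conjunction, projection, specialization and sum of pp formulas *)

Section PPConstructions.
Variable R : pzRingType.

Definition pp_eq n (c : 'rV[R]_n) : pp R n := @PP R n 0 1 c 0.

Lemma pp_eqE n (c : 'rV[R]_n) (M : lmodType R) (x : 'I_n -> M) :
  pp_sat (pp_eq c) x <-> \sum_j c 0 j *: x j = 0.
Proof.
split=> [[y /(_ 0)]|cx]; first by rewrite [X in _ + X]big_ord0 addr0.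
by exists (fun=> 0) => e; rewrite [X in _ + X]big_ord0 addr0 ord1.
Qed.

Definition pp_zero n : pp R n := @PP R n 0 n 1%:M 0.

Lemma sum_scalar_mx n (M : lmodType R) (x : 'I_n -> M) e :
  \sum_j (1%:M : 'M[R]_n) e j *: x j = x e.
Proof.
rewrite (bigD1 e) //= mxE eqxx scale1r big1 ?addr0 // => j /negPf je.
by rewrite mxE eq_sym je scale0r.
Qed.

Lemma pp_zeroE n (M : lmodType R) (x : 'I_n -> M) :
  pp_sat (pp_zero n) x <-> forall j, x j = 0.
Proof.
split=> [[y xy] j|x0]; last first.
  by exists (fun=> 0) => e; rewrite [X in _ + X]big_ord0 addr0 sum_scalar_mx.
by have := xy j; rewrite [X in _ + X]big_ord0 addr0 sum_scalar_mx.
Qed.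

Definition pp_and n (phi psi : pp R n) : pp R n :=
  PP (col_mx (pp_free_coef phi) (pp_free_coef psi))
     (block_mx (pp_bound_coef phi) 0 0 (pp_bound_coef psi)).

Lemma pp_andE n (phi psi : pp R n) (M : lmodType R) (x : 'I_n -> M) :
  pp_sat (pp_and phi psi) x <-> pp_sat phi x /\ pp_sat psi x.
Proof.
split=> [[y xy]|[[y xy] [z xz]]].
  split; [exists (fun l => y (lshift _ l))|exists (fun l => y (rshift _ l))];
    move=> e; [rewrite -[RHS](xy (lshift _ e))|rewrite -[RHS](xy (rshift _ e))];
    rewrite [in RHS]big_split_ord /=; congr (_ + _).
  - by apply: eq_bigr => j _; rewrite col_mxEu.
  - rewrite [X in _ = _ + X]big1 ?addr0 => [|l _]; last first.
      by rewrite block_mxEur mxE scale0r.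
    by apply: eq_bigr => l _; rewrite block_mxEul.
  - by apply: eq_bigr => j _; rewrite col_mxEd.
  - rewrite [X in _ = X + _]big1 ?add0r => [|l _]; last first.
      by rewrite block_mxEdl mxE scale0r.
    by apply: eq_bigr => l _; rewrite block_mxEdr.
exists (fun l => match split l with inl i => y i | inr i => z i end) => e.
rewrite big_split_ord /=.
under [X in _ + (X + _)]eq_bigr => l _ do rewrite (unsplitK (inl l)).
under [X in _ + (_ + X)]eq_bigr => l _ do rewrite (unsplitK (inr l)).
rewrite -(splitK e); case: (split e) => {}e /=.
- rewrite [X in _ + (_ + X)]big1 ?addr0 => [|l _]; last first.
    by rewrite block_mxEur mxE scale0r.
  rewrite -[RHS](xy e); congr (_ + _); apply: eq_bigr => l _.
    by rewrite col_mxEu.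
  by rewrite block_mxEul.
- rewrite [X in _ + (X + _)]big1 ?add0r => [|l _]; last first.
    by rewrite block_mxEdl mxE scale0r.
  rewrite -[RHS](xz e); congr (_ + _); apply: eq_bigr => l _.
    by rewrite col_mxEd.
  by rewrite block_mxEdr.
Qed.

(** [pp_eq 0] is the equation 0 = 0, which serves as the empty conjunction. *)
Definition pp_all n (I : finType) (P : {set I}) (phi : I -> pp R n) : pp R n :=
  foldr (fun i => pp_and (phi i)) (pp_eq 0) (enum P).

Lemma pp_allE n (I : finType) (P : {set I}) (phi : I -> pp R n)
    (M : lmodType R) (x : 'I_n -> M) :
  pp_sat (pp_all P phi) x <-> forall i, i \in P -> pp_sat (phi i) x.
Proof.
suff foldE s : pp_sat (foldr (fun i => pp_and (phi i)) (pp_eq 0) s) x <->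
    forall i, i \in s -> pp_sat (phi i) x.
  rewrite foldE; split=> px i iP; apply: px; first by rewrite mem_enum.
  by rewrite mem_enum in iP.
elim: s => [|i s IH] /=.
  split=> // _; apply/pp_eqE; rewrite big1 // => j _.
  by rewrite mxE scale0r.
rewrite pp_andE IH; split=> [[pi ps] j|ps].
  by rewrite inE => /predU1P[->|/ps].
split=> [|j js]; first by apply: ps; rewrite mem_head.
by apply: ps; rewrite inE js orbT.
Qed.

Definition pp_ex n (phi : pp R n.+1) : pp R n :=
  PP (col' ord0 (pp_free_coef phi))
     (row_mx (col ord0 (pp_free_coef phi)) (pp_bound_coef phi)).

Lemma vcons0 n (M : lmodType R) (x : M) (v : 'I_n -> M) : vcons x v ord0 = x.
Proof. by rewrite /vcons unlift_none. Qed.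

Lemma vconsS n (M : lmodType R) (x : M) (v : 'I_n -> M) j :
  vcons x v (lift ord0 j) = v j.
Proof. by rewrite /vcons liftK. Qed.

Lemma vcons_lin n (M N : lmodType R) (f : {linear M -> N}) x (v : 'I_n -> M) :
  f \o vcons x v = vcons (f x) (f \o v).
Proof. by apply/funext => j; rewrite /= /vcons; case: unlift. Qed.

Lemma vcons_sub n (M : lmodType R) (x x' : M) (v v' : 'I_n -> M) :
  (fun j => vcons x v j - vcons x' v' j) =
    vcons (x - x') (fun j => v j - v' j).
Proof. by apply/funext => j; rewrite /vcons; case: unlift. Qed.

Lemma pp_exE n (phi : pp R n.+1) (M : lmodType R) (v : 'I_n -> M) :
  pp_sat (pp_ex phi) v <-> exists x, pp_sat phi (vcons x v).
Proof.
split=> [[y xy]|[x [y xy]]].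
  exists (y (lshift _ ord0)), (fun l => y (rshift 1 l)) => e.
  rewrite -[RHS](xy e) /= big_ord_recl vcons0 big_split_ord /= big_ord1.
  rewrite row_mxEl mxE -addrA addrCA; congr (_ + (_ + _)).
    by apply: eq_bigr => j _; rewrite vconsS mxE.
  by apply: eq_bigr => l _; rewrite row_mxEr.
exists (fun l => match split l with inl _ => x | inr i => y i end) => e.
rewrite -[RHS](xy e) /= big_split_ord /= big_ord1 (unsplitK (inl _)).
rewrite big_ord_recl vcons0 row_mxEl mxE addrCA addrA.
congr (_ + _ + _).
  by apply: eq_bigr => j _; rewrite vconsS mxE.
by apply: eq_bigr => l _; rewrite row_mxEr (unsplitK (inr _)).
Qed.

(** Setting the parameters to zero drops their columns. The solutions of [phi] over fixed
    parameters, if there are any, form a coset of the subgroup that this formula defines. *)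
Definition pp_at0 n (phi : pp R n.+1) : pp R 1 :=
  PP (col ord0 (pp_free_coef phi)) (pp_bound_coef phi).

Lemma pp_at0E n (phi : pp R n.+1) (M : lmodType R) (x : 'I_1 -> M) :
  pp_sat (pp_at0 phi) x <-> pp_sat phi (vcons (x ord0) (fun=> 0)).
Proof.
have E e : \sum_(j < n.+1) pp_free_coef phi e j *: vcons (x ord0) (fun=> 0) j =
    \sum_(j < 1) pp_free_coef (pp_at0 phi) e j *: x j.
  rewrite big_ord_recl vcons0 big1 ?addr0 => [|j _].
    by rewrite big_ord1 mxE.
  by rewrite vconsS scaler0.
by split=> -[y xy]; exists y => e; have := xy e; rewrite E.
Qed.

(* The sum phi + psi, written with a single copy z of the free variables as
   exists z, phi(x - z) /\ psi(z). *)
Definition pp_add n (phi psi : pp R n) : pp R n :=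
  PP (col_mx (pp_free_coef phi) 0)
     (block_mx (- pp_free_coef phi) (row_mx (pp_bound_coef phi) 0)
               (pp_free_coef psi) (row_mx 0 (pp_bound_coef psi))).

Lemma sum_coef0 m k (M : lmodType R) (x : 'I_m -> M) (e : 'I_k) :
  \sum_j (0 : 'M[R]_(k, m)) e j *: x j = 0.
Proof. by rewrite big1 // => j _; rewrite mxE scale0r. Qed.

Lemma pp_addE n (phi psi : pp R n) (M : lmodType R) (x : 'I_n -> M) :
  pp_sat (pp_add phi psi) x <->
  exists2 z : 'I_n -> M, pp_sat phi (fun j => x j - z j) & pp_sat psi z.
Proof.
have E1 (w : 'I_(n + (pp_bound phi + pp_bound psi)) -> M) e :
    \sum_j pp_free_coef (pp_add phi psi) (lshift _ e) j *: x j +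
    \sum_l pp_bound_coef (pp_add phi psi) (lshift _ e) l *: w l =
    \sum_j pp_free_coef phi e j *: (x j - w (lshift _ j)) +
    \sum_l pp_bound_coef phi e l *: w (rshift _ (lshift _ l)).
  rewrite big_split_ord big_split_ord /= [X in _ + (_ + (_ + X))]big1 => [|l _].
    under [in RHS]eq_bigr do rewrite scalerBr.
    rewrite sumrB addr0 addrA; congr (_ + _ + _).
    - by apply: eq_bigr => j _; rewrite col_mxEu.
    - by rewrite -sumrN; apply: eq_bigr => j _; rewrite block_mxEul mxE scaleNr.
    - by apply: eq_bigr => j _; rewrite block_mxEur row_mxEl.
  by rewrite block_mxEur row_mxEr mxE scale0r.
have E2 (w : 'I_(n + (pp_bound phi + pp_bound psi)) -> M) e :
    \sum_j pp_free_coef (pp_add phi psi) (rshift _ e) j *: x j +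
    \sum_l pp_bound_coef (pp_add phi psi) (rshift _ e) l *: w l =
    \sum_j pp_free_coef psi e j *: w (lshift _ j) +
    \sum_l pp_bound_coef psi e l *: w (rshift _ (rshift _ l)).
  rewrite big_split_ord big_split_ord /= [X in X + _]big1 => [|j _]; last first.
    by rewrite col_mxEd mxE scale0r.
  rewrite add0r [X in _ + (X + _)]big1 => [|j _]; last first.
    by rewrite block_mxEdr row_mxEl mxE scale0r.
  rewrite add0r; congr (_ + _); apply: eq_bigr => j _.
    by rewrite block_mxEdl.
  by rewrite block_mxEdr row_mxEr.
split=> [[w xw]|[z [y xy] [y' zy']]].
  exists (fun j => w (lshift _ j)).
    by exists (fun l => w (rshift _ (lshift _ l))) => e; rewrite -E1.
  by exists (fun l => w (rshift _ (rshift _ l))) => e; rewrite -E2.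
exists (fun l => match split l with
  | inl i => z i
  | inr i => match split i with inl i => y i | inr i => y' i end
  end) => e.
rewrite -(splitK e); case: (split e) => {}e; rewrite [unsplit _]/=.
- rewrite E1 -[RHS](xy e); congr (_ + _); apply: eq_bigr => j _.
    by rewrite (unsplitK (inl _)).
  by rewrite (unsplitK (inr _)) (unsplitK (inl _)).
- rewrite E2 -[RHS](zy' e); congr (_ + _); apply: eq_bigr => j _.
    by rewrite (unsplitK (inl _)).
  by rewrite !(unsplitK (inr _)).
Qed.

End PPConstructions.

(** * Direct sums *)

Section DirectSum.
Variables (R : pzRingType) (I : Type) (C : I -> lmodType R).

Lemma dsum_ext (f g : dsum C) : (forall i, dsum_val f i = dsum_val g i) -> f = g.
Proof. by move=> fg; apply/val_inj/functional_extensionality_dep. Qed.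

Lemma dsum_supp (f : dsum C) :
  exists s : seq {classic I}, forall i : {classic I}, i \notin s -> dsum_val f i = 0.
Proof.
have /asboolP/(@finite_seqP {classic I})[s fs] := valP f.
exists s => i; apply: contraNP => fi0.
by move: fs => /seteqP[+ _] => /(_ i fi0).
Qed.

Lemma in_finsupp (s : seq {classic I}) (f : dprod C) :
  (forall i : {classic I}, i \notin s -> f i = 0) -> f \in finsupp (M := C).
Proof.
move=> fs; apply/asboolP; apply: (@sub_finite_set {classic I} _ [set` s]%classic).
  by move=> i /= fi0; apply/negPn/negP => /fs.
exact: finite_seq.
Qed.

(** Since [C j] depends on the index, [x] has to be transported along [i = j]; proof irrelevance
    makes the transport at [i] itself trivial. *)
Definition dprod_single i (x : C i) : dprod C := fun j =>
  match pselect (i = j) with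
  | left e => eq_rect i (fun k => C k : Type) x j e
  | right _ => 0
  end.

Lemma dprod_single_id i (x : C i) : dprod_single x i = x.
Proof.
by rewrite /dprod_single; case: pselect => // e; rewrite (Prop_irrelevance e erefl).
Qed.

Lemma dprod_single_neq i j (x : C i) : i <> j -> dprod_single x j = 0.
Proof. by rewrite /dprod_single; case: pselect. Qed.

Lemma dprod_single_finsupp i (x : C i) : dprod_single x \in finsupp (M := C).
Proof.
apply: (@in_finsupp [:: i]) => j ji; apply: dprod_single_neq => ij.
by rewrite inE ij eqxx in ji.
Qed.

Definition dsum_in i (x : C i) : dsum C := DSum (dprod_single_finsupp x).

Fact dsum_in_linear i : linear (@dsum_in i).
Proof.
move=> r x y; apply: dsum_ext => j.
have -> : dsum_val (r *: dsum_in x + dsum_in y) j =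
  r *: dsum_val (dsum_in x) j + dsum_val (dsum_in y) j by [].
have [ij|ij] := pselect (i = j).
  by case: _ / ij; rewrite /= !dprod_single_id.
by rewrite /= !dprod_single_neq // scaler0 addr0.
Qed.
HB.instance Definition _ i :=
  GRing.isLinear.Build R (C i) (dsum C) *:%R (@dsum_in i) (@dsum_in_linear i).

Definition dsum_proj i (f : dsum C) : C i := dsum_val f i.

Fact dsum_proj_linear i : linear (dsum_proj i).
Proof. by []. Qed.
HB.instance Definition _ i :=
  GRing.isLinear.Build R (dsum C) (C i) *:%R (dsum_proj i) (dsum_proj_linear i).

Lemma dsum_inK i : cancel (@dsum_in i) (dsum_proj i).
Proof. exact: dprod_single_id. Qed.

(** The finitely many entries have finite supports, so erasing one coordinate at a time reaches the
    zero tuple. The induction runs over a list that contains all these supports. *)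
Lemma dsum_tuple_ind n (P : ('I_n -> dsum C) -> Prop) :
  P (fun=> 0) ->
  (forall i x, P (fun j => x j - dsum_in (dsum_proj i (x j))) -> P x) ->
  forall x, P x.
Proof.
move=> P0 PS x.
have /choice[supp xsupp] : forall j, exists s : seq {classic I},
  forall i : {classic I}, i \notin s -> dsum_val (x j) i = 0 by move=> j; apply: dsum_supp.
have: forall (i : {classic I}) j, i \notin flatten [seq supp j | j <- enum 'I_n] ->
    dsum_val (x j) i = 0.
  move=> i j ins; apply: xsupp; apply: contra ins => ij.
  by apply/flatten_mapP; exists j; rewrite ?mem_enum.
move: {xsupp} (flatten _) => s.
elim: s x => [|i s IH] x xs.
  suff -> : x = fun=> 0 by [].
  by apply/funext => j; apply: dsum_ext => i; apply: xs.
apply: (PS i); apply: IH => k j ks.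
have -> : dsum_val (x j - dsum_in (dsum_proj i (x j))) k =
  dsum_val (x j) k - dsum_val (dsum_in (dsum_proj i (x j))) k by [].
have [->|ik] := pselect (k = i).
  by rewrite [X in _ - X](dsum_inK (dsum_val (x j) i)) subrr.
rewrite [X in _ - X]dprod_single_neq ?subr0 => [|/esym //].
by apply: xs; rewrite inE negb_or ks andbT; apply/eqP.
Qed.

(** Linear maps preserve pp formulas: project to a coordinate, apply the hypothesis there, embed
    back, and add the remainder, which the induction handles. *)
Lemma pp_sub_dsum n (phi psi : pp R n) :
  (forall i (x : 'I_n -> C i), pp_sat phi x -> pp_sat psi x) ->
  forall x : 'I_n -> dsum C, pp_sat phi x -> pp_sat psi x.
Proof.
move=> phipsi; apply: dsum_tuple_ind => [_|i x IH phix]; first exact: pp_sat0.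
have phixi : pp_sat phi (fun j => dsum_proj i (x j)).
  exact: (pp_sat_lin (dsum_proj i)).
have /(pp_sat_lin (@dsum_in i)) psixi := phipsi _ _ phixi.
have {}IH := IH (pp_satB phix (pp_sat_lin (@dsum_in i) phixi)).
by apply: pp_sat_eq (pp_satD IH psixi) => j; rewrite /= subrK.
Qed.

End DirectSum.

(** * Elimination down to pp formulas *)

Section ElementaryEquivalence.
Variables (R : pzRingType) (I : Type) (A : I -> lmodType R).

(** This is membership of [M] in the definable subcategory generated by the [A i]. *)
Definition pp_dominated (M : lmodType R) : Prop :=
  forall n (phi psi : pp R n),
  (forall i (x : 'I_n -> A i), pp_sat phi x -> pp_sat psi x) ->
  forall x : 'I_n -> M, pp_sat phi x -> pp_sat psi x.

Definition fresh_summand i (M : lmodType R) : Prop :=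
  forall n (v : 'I_n -> M), exists (f : {linear A i -> M}) (p : {linear M -> A i}),
  cancel f p /\ forall j, p (v j) = 0.

Definition fresh (M : lmodType R) : Prop :=
  pp_dominated M /\ forall i, fresh_summand i M.

(** A form of Baur-Monk elimination relative to fresh modules. There the index of a pp pair is 1 or
    infinite, in the same way for all of them, so a finite pattern of pp formulas can decide [s]
    across different modules. *)
Definition pp_determines n (s : fo R n) (J : finType) (Phi : J -> pp R n) :=
  forall (M N : lmodType R) (u : 'I_n -> M) (v : 'I_n -> N),
  fresh M -> fresh N ->
  (forall i, pp_sat (Phi i) u <-> pp_sat (Phi i) v) ->
  fo_sat s u <-> fo_sat s v.

(* Adding a fresh copy of an element of [A i] lying in [theta] but not in [psi]
   destroys [psi] without restoring any formula that already fails. *)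
Lemma fresh_avoid n (theta : pp R n.+1) (J : finType) (Phi : J -> pp R n.+1)
    (P : {set J}) (N : lmodType R) (v : 'I_n -> N) :
  fresh N -> (exists y, pp_sat theta (vcons y v)) ->
  (forall j, j \in P -> (exists2 y, pp_sat theta (vcons y v) &
      pp_sat (Phi j) (vcons y v)) ->
    exists i (z : A i), pp_sat theta (vcons z (fun=> 0)) /\
      ~ pp_sat (Phi j) (vcons z (fun=> 0))) ->
  exists2 y, pp_sat theta (vcons y v) &
    forall j, j \in P -> ~ pp_sat (Phi j) (vcons y v).
Proof.
move=> [_ freshN] [y0 ty0] witness.
suff [y ty Py] : exists2 y, pp_sat theta (vcons y v) &
    forall j, j \in enum P -> ~ pp_sat (Phi j) (vcons y v).
  by exists y => // j jP; apply: Py; rewrite mem_enum.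
have: forall j, j \in enum P -> j \in P by move=> j; rewrite mem_enum.
elim: (enum P) => [|j s IH] sP; first by exists y0.
have [|y ty sy] := IH; first by move=> k ks; apply: sP; rewrite inE ks orbT.
have [jy|jy] := pselect (pp_sat (Phi j) (vcons y v)); last first.
  by exists y => // k; rewrite inE => /predU1P[->|/sy].
have [] := witness j; [exact/sP/mem_head|by exists y|].
move=> i [z [tz jz]].
(* The copy is chosen to avoid [y] as well as the parameters, so [p] reads off exactly [z] from
   [y + f z]. *)
have [f [p [fK pv]]] := freshN i _ (vcons y v).
have pv' l : p (v l) = 0 by rewrite -(vconsS y v) pv.
have py : p y = 0 by rewrite -(vcons0 y v) pv.
exists (y + f z).
  apply: pp_sat_eq (pp_satD ty (pp_sat_lin f tz)) => l.
  rewrite vcons_lin /vcons; case: unlift => [l'|] //=.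
  by rewrite raddf0 addr0.
move=> k; rewrite inE => /predU1P[->|ks] ky.
  apply: jz; apply: pp_sat_eq (pp_sat_lin p ky) => l.
  rewrite vcons_lin raddfD /= py add0r fK /vcons; case: unlift => //=.
(* Removing the component in the copy turns [y + f z] back into [y], where [Phi k] already fails. *)
apply: (sy k ks).
apply: pp_sat_eq (pp_satB ky (pp_sat_lin f (pp_sat_lin p ky))) => l.
rewrite !vcons_lin raddfD /= py add0r fK /vcons; case: unlift => [l'|] /=.
  by rewrite pv' raddf0 subr0.
by rewrite addrK.
Qed.

(** The conjunction [theta] of the formulas true at [x] has a solution over [v] by hypothesis;
    [fresh_avoid] then makes all the other formulas fail. *)
Lemma fresh_back_and_forth n (J : finType) (Phi : J -> pp R n.+1)
    (M N : lmodType R) (u : 'I_n -> M) (v : 'I_n -> N) :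
  fresh M -> fresh N ->
  (forall P : {set J},
    pp_sat (pp_ex (pp_all P Phi)) u <-> pp_sat (pp_ex (pp_all P Phi)) v) ->
  forall x, exists y, forall j,
    pp_sat (Phi j) (vcons x u) <-> pp_sat (Phi j) (vcons y v).
Proof.
move=> freshM freshN uv x.
pose P := [set j | `[< pp_sat (Phi j) (vcons x u) >]].
pose theta := pp_all P Phi.
have thetax : pp_sat theta (vcons x u).
  by apply/pp_allE => j; rewrite inE => /asboolP.
have thetav : exists y, pp_sat theta (vcons y v).
  by apply/pp_exE/uv/pp_exE; exists x.
have [|y ty yP] := @fresh_avoid n theta J Phi (~: P) N v freshN thetav.
  move=> j jP [y ty jy].
  (* If [theta] and [Phi j] have a common solution over [v], the hypothesis for [j |: P] brings one
     back over [u]. *)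
  have /pp_exE[x' /pp_allE x'P] : pp_sat (pp_ex (pp_all (j |: P) Phi)) u.
    apply/uv/pp_exE; exists y; apply/pp_allE => k.
    rewrite in_setU1 => /predU1P[->//|kP].
    by move/pp_allE : ty; apply.
  have thetax' : pp_sat theta (vcons x' u).
    by apply/pp_allE => k kP; apply: x'P; rewrite in_setU1 kP orbT.
  have jx' : pp_sat (Phi j) (vcons x' u) by apply: x'P; rewrite setU11.
  (* Without a witness, [theta] over zero parameters implies [Phi j] in every [A i], hence in [M].
     So [x - x'] satisfies [Phi j], and adding [x'] yields [Phi j] at [x], against [j] lying outside
     [P]. *)
  apply: contrapT => no_witness; move: jP; rewrite !inE => /asboolP; apply.
  have sub0 i (z : 'I_1 -> A i) :
      pp_sat (pp_at0 theta) z -> pp_sat (pp_at0 (Phi j)) z.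
    rewrite !pp_at0E => tz; apply: contrapT => jz; apply: no_witness.
    by exists i, (z ord0).
  have := freshM.1 _ _ _ sub0 (fun=> x - x'); rewrite !pp_at0E => dx.
  have vB : (fun l => vcons x u l - vcons x' u l) = vcons (x - x') (fun=> 0).
    by rewrite vcons_sub; congr vcons; apply/funext => l; rewrite subrr.
  apply: pp_sat_eq (pp_satD (dx _) jx').
    by move=> l; rewrite -vB subrK.
  by rewrite -vB; apply: pp_satB.
exists y => j; have [jP|jP] := boolP (j \in P).
  split=> _; first by move/pp_allE : ty; apply.
  by move: jP; rewrite inE => /asboolP.
split=> jx; last by have [] := yP j; rewrite ?inE // in jP *.
by move: jP; rewrite inE => /asboolP[].
Qed.

Fixpoint mterm_coef n (t : mterm R n) : 'rV[R]_n :=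
  match t with
  | MVar i => delta_mx 0 i
  | MZero => 0
  | MAdd t u => mterm_coef t + mterm_coef u
  | MOpp t => - mterm_coef t
  | MScale r t => r *: mterm_coef t
  end.

Lemma mterm_coefE n (t : mterm R n) (M : lmodType R) (v : 'I_n -> M) :
  mterm_eval v t = \sum_j mterm_coef t 0 j *: v j.
Proof.
elim: t => [i||t IHt t' IHt'|t IH|r t IH] /=.
- rewrite (bigD1 i) //= mxE !eqxx scale1r big1 ?addr0 // => j /negPf ji.
  by rewrite mxE ji andbF scale0r.
- by rewrite sum_coef0.
- by rewrite IHt IHt' -big_split; apply: eq_bigr => j _; rewrite mxE scalerDl.
- by rewrite IH -sumrN; apply: eq_bigr => j _; rewrite mxE scaleNr.
- by rewrite IH scaler_sumr; apply: eq_bigr => j _; rewrite mxE scalerA.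
Qed.

(** Binary connectives take the disjoint union of two families. A quantifier takes the projected
    conjunctions over all subsets of the family, which is what the back-and-forth step consumes. *)
Lemma pp_determines_fo n (s : fo R n) :
  exists (J : finType) (Phi : J -> pp R n), pp_determines s Phi.
Proof.
have binary m (s1 s2 : fo R m) :
    (exists (J : finType) (Phi : J -> pp R m), pp_determines s1 Phi) ->
    (exists (J : finType) (Phi : J -> pp R m), pp_determines s2 Phi) ->
    exists (J : finType) (Phi : J -> pp R m),
      pp_determines s1 Phi /\ pp_determines s2 Phi.
  move=> [J1 [Phi1 det1]] [J2 [Phi2 det2]]; exists (J1 + J2)%type.
  exists (fun j => match j with inl i => Phi1 i | inr i => Phi2 i end).
  split=> M N u v fM fN uv; [apply: det1|apply: det2] => // j.
    exact: (uv (inl j)).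
  exact: (uv (inr j)).
elim: s => {n} [n t t'|n s [J [Phi det]]|n s1 IH1 s2 IH2|n s1 IH1 s2 IH2|
    n s1 IH1 s2 IH2|n s [J [Phi det]]|n s [J [Phi det]]].
- exists unit, (fun=> pp_eq (mterm_coef t - mterm_coef t')) => M N u v _ _ uv.
  have E (K : lmodType R) (w : 'I_n -> K) : fo_sat (FEq t t') w <->
      pp_sat (pp_eq (mterm_coef t - mterm_coef t')) w.
    rewrite pp_eqE /=; under eq_bigr do rewrite !mxE scalerBl.
    rewrite sumrB -!mterm_coefE; split=> [->|/eqP]; first exact: subrr.
    by rewrite subr_eq0 => /eqP.
  by rewrite !E; apply: (uv tt).
- exists J, Phi => M N u v fM fN uv /=.
  by have := det M N u v fM fN uv; tauto.
- have [J [Phi [det1 det2]]] := binary _ _ _ IH1 IH2.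
  exists J, Phi => M N u v fM fN uv /=.
  by have := det1 M N u v fM fN uv; have := det2 M N u v fM fN uv; tauto.
- have [J [Phi [det1 det2]]] := binary _ _ _ IH1 IH2.
  exists J, Phi => M N u v fM fN uv /=.
  by have := det1 M N u v fM fN uv; have := det2 M N u v fM fN uv; tauto.
- have [J [Phi [det1 det2]]] := binary _ _ _ IH1 IH2.
  exists J, Phi => M N u v fM fN uv /=.
  by have := det1 M N u v fM fN uv; have := det2 M N u v fM fN uv; tauto.
- exists {set J}, (fun P => pp_ex (pp_all P Phi)) => M N u v fM fN uv /=.
  split=> su x.
    have [y xy] := fresh_back_and_forth fN fM (fun P => iff_sym (uv P)) x.
    by apply/(det _ _ _ _ fN fM xy)/su.
  have [y xy] := fresh_back_and_forth fM fN uv x.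
  by apply/(det _ _ _ _ fM fN xy)/su.
- exists {set J}, (fun P => pp_ex (pp_all P Phi)) => M N u v fM fN uv /=.
  split=> -[x sx].
    have [y xy] := fresh_back_and_forth fM fN uv x.
    by exists y; apply/(det _ _ _ _ fM fN xy).
  have [y xy] := fresh_back_and_forth fN fM (fun P => iff_sym (uv P)) x.
  by exists y; apply/(det _ _ _ _ fN fM xy).
Qed.

Lemma fresh_elem_equiv (M N : lmodType R) : fresh M -> fresh N -> elem_equiv M N.
Proof.
move=> fM fN s; have [J [Phi det]] := pp_determines_fo s.
(* The empty tuple is also the zero tuple, which satisfies every pp formula. *)
have all_sat (K : lmodType R) (u : 'I_0 -> K) j : pp_sat (Phi j) u.
  by apply: pp_sat_eq (pp_sat0 _ _) => -[].
have E (u : 'I_0 -> M) (v : 'I_0 -> N) : fo_sat s u <-> fo_sat s v.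
  by apply: det => // j; split.
split=> sM v; first by apply/(E (fun=> 0))/sM.
by apply/(E v (fun=> 0))/sM.
Qed.

End ElementaryEquivalence.

(** * Quotients and direct limits *)

Section QuotientModule.
Local Open Scope quotient_scope.
Variables (R : pzRingType) (V : lmodType R) (S : V -> Prop).
Hypothesis S0 : S 0.
Hypothesis SZD : forall r x y, S x -> S y -> S (r *: x + y).

Definition submod_pred : pred V := fun x => `[< S x >].

Fact submod_pred_closed : submod_closed submod_pred.
Proof.
split=> [|r x y /asboolP Sx /asboolP Sy]; first exact/asboolP.
exact/asboolP/SZD.
Qed.

Definition submod : zmodClosed V := HB.pack_for (zmodClosed V) submod_pred
  (GRing.isZmodClosed.Build V submod_pred (GRing.submod_closedB submod_pred_closed)).

Local Notation Q := (Quotient.quot submod).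

Definition quot_scale (r : R) (x : Q) : Q := \pi_Q (r *: repr x).

Lemma quot_scale_pi r x : quot_scale r (\pi_Q x) = \pi_Q (r *: x).
Proof.
apply/eqP; rewrite -Quotient.idealrBE -scalerBr.
apply: (GRing.subsemimod_closedZ (GRing.submod_closed_semi submod_pred_closed)).
by rewrite (Quotient.idealrBE submod) reprK.
Qed.

Lemma quot_piD (x y : V) : \pi_Q (x + y) = \pi_Q x + \pi_Q y.
Proof. exact: raddfD. Qed.

Fact quot_scalerA r s x : quot_scale r (quot_scale s x) = quot_scale (r * s) x.
Proof. by elim/quotW: x => x; rewrite (quot_scale_pi s) !quot_scale_pi scalerA. Qed.

Fact quot_scale1r : left_id 1 quot_scale.
Proof. by elim/quotW=> x; rewrite quot_scale_pi scale1r. Qed.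

Fact quot_scalerDr : right_distributive quot_scale +%R.
Proof.
move=> r; elim/quotW=> x; elim/quotW=> y; rewrite -quot_piD !quot_scale_pi.
by rewrite scalerDr quot_piD.
Qed.

Fact quot_scalerDl x : {morph quot_scale^~ x : r s / r + s}.
Proof. by elim/quotW: x => x r s; rewrite !quot_scale_pi scalerDl quot_piD. Qed.

HB.instance Definition _ := GRing.Zmodule_isLmodule.Build R Q
  quot_scalerA quot_scale1r quot_scalerDr quot_scalerDl.

Definition quot_pi : V -> Q := \pi_Q.

Fact quot_pi_linear : linear quot_pi.
Proof. by move=> r x y; rewrite /quot_pi quot_piD -quot_scale_pi. Qed.
HB.instance Definition _ := GRing.isLinear.Build R V Q *:%R quot_pi quot_pi_linear.

Lemma quotient_linear :
  exists (W : lmodType R) (q : {linear V -> W}), forall x, q x = 0 <-> S x.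
Proof.
exists Q, quot_pi => x; rewrite -(raddf0 quot_pi).
have := Quotient.idealrBE submod x 0; rewrite subr0 => xS.
by split=> [/eqP|Sx]; [rewrite -xS => /asboolP|apply/eqP; rewrite -xS; apply/asboolP].
Qed.

End QuotientModule.

(** * Eventual properties, and elements and pp formulas in a sequential direct limit *)

Definition eventually (P : nat -> Prop) := exists k, forall i, (k <= i)%N -> P i.

Lemma eventually_forall (T : finType) (P : T -> nat -> Prop) :
  (forall t, eventually (P t)) -> eventually (fun i => forall t, P t i).
Proof.
move=> /choice[k kP]; exists (\max_t k t)%N => i ki t; apply: kP.
exact: leq_trans (leq_bigmax t) ki.
Qed.

Lemma eventually_and (P Q : nat -> Prop) :
  eventually P -> eventually Q -> eventually (fun i => P i /\ Q i).
Proof.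
move=> [k kP] [l lQ]; exists (maxn k l) => i; rewrite geq_max => /andP[ki li].
by split; [apply: kP|apply: lQ].
Qed.

Lemma eventually_imp (P Q : nat -> Prop) :
  (forall i, P i -> Q i) -> eventually P -> eventually Q.
Proof. by move=> PQ [k kP]; exists k => i /kP/PQ. Qed.

Section DirectLimitTheory.
Variables (R : pzRingType) (A : nat -> lmodType R).
Variable g : forall i, {linear A i -> A i.+1}.

(* The image of [x : A i] in [A j]; junk (zero) when [j < i]. *)
Fixpoint push i (x : A i) (j : nat) : A j :=
  match j with
  | 0 => dprod_single (C := A) x 0%N
  | j'.+1 => if (i <= j')%N then g j' (push x j') else dprod_single (C := A) x j'.+1
  end.

Lemma push_id i (x : A i) : push x i = x.
Proof. by case: i x => [|i] x /=; rewrite ?ltnn dprod_single_id. Qed.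

Lemma pushS i (x : A i) j : (i <= j)%N -> push x j.+1 = g j (push x j).
Proof. by move=> /= ->. Qed.

(** A sequence that follows the maps [g] from [i] on is determined by its value at [i], by induction
    on the distance. *)
Lemma push_eq i (c : forall j, A j) :
  (forall j, (i <= j)%N -> c j.+1 = g j (c j)) ->
  forall j, (i <= j)%N -> push (c i) j = c j.
Proof.
move=> cg j /subnK<-; elim: (j - i)%N => [|k IH]; first by rewrite push_id.
by rewrite addSn pushS ?leq_addl // IH cg // leq_addl.
Qed.

Lemma push_linear i j r (x y : A i) : (i <= j)%N ->
  push (r *: x + y) j = r *: push x j + push y j.
Proof.
move=> ij; pose c k := r *: push x k + push y k.
rewrite -[RHS]/(c j) -[in LHS](push_id x) -[in LHS](push_id y).
apply: (@push_eq i c) => // k ik; rewrite /c !pushS // linearP //.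
Qed.

Variables (B : lmodType R) (h : forall i, {linear A i -> B}).
Hypothesis B_lim : direct_limit g h.

Lemma limit_push i (x : A i) j : (i <= j)%N -> h j (push x j) = h i x.
Proof.
move=> /subnK<-; elim: (j - i)%N => [|k IH]; first by rewrite push_id.
by rewrite addSn pushS ?leq_addl // B_lim.1.
Qed.

(* The images of the [h i] form a submodule [S]; the projection to [B / S] and
   the zero map agree on every [A i], so they are equal. *)
Lemma limit_surj (b : B) : exists i (x : A i), h i x = b.
Proof.
pose S (b : B) := exists i (x : A i), h i x = b.
have [||W [q qS]] := @quotient_linear R B S.
- by exists 0, 0; rewrite raddf0.
- move=> r _ _ [i [x <-]] [j [y <-]]; exists (maxn i j).
  exists (r *: push x (maxn i j) + push y (maxn i j)).
  by rewrite linearP !limit_push // leq_max leqnn ?orbT.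
have [//|u _ uniq_u] := B_lim.2 W (fun i => \0 : {linear A i -> W}).
apply/qS; rewrite (uniq_u q) => [|i x]; last by apply/qS; exists i, x.
by rewrite -(uniq_u (\0 : {linear B -> W})).
Qed.

(* The quotient of the product of the [A i] by the eventually zero sequences
   receives a compatible family of maps whose value at [x : A i] vanishes only
   if the image of [x] in some [A j] does. *)
Lemma limit_eq0 i (x : A i) : h i x = 0 -> eventually (fun j => push x j = 0).
Proof.
pose S (c : dprod A) := eventually (fun j => c j = 0).
have [||W [q qS]] := @quotient_linear R (dprod A) S.
- by exists 0.
- move=> r c d c0 d0; apply: eventually_imp (eventually_and c0 d0) => j [cj dj].
  have -> : (r *: c + d) j = r *: c j + d j by [].
  by rewrite cj dj scaler0 addr0.
pose k i (x : A i) : W := q (push x : dprod A).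
have q_eq (c d : dprod A) : eventually (fun j => c j = d j) -> q c = q d.
  move=> cd; apply/eqP; rewrite -subr_eq0 -raddfB; apply/eqP/qS.
  apply: eventually_imp cd => j cdj.
  have -> : (c - d) j = c j - d j by [].
  by rewrite cdj subrr.
have k_linear m : linear (k m).
  move=> r y z; rewrite /k -linearP; apply: q_eq; exists m => j mj.
  exact: push_linear.
pose K m : {linear A m -> W} :=
  HB.pack (k m) (GRing.isLinear.Build R (A m) W *:%R (k m) (k_linear m)).
have [|u uK _] := B_lim.2 W K.
  move=> m y; apply: q_eq; exists m.+1 => j mj.
  (* Since [g m y] is the value of [push y] at [m.+1], the two sequences agree from there on. *)
  rewrite -[y in g m y](push_id y) -pushS //.
  by apply: push_eq => // l ml; rewrite pushS // ltnW.
by move=> hx; apply/qS; rewrite -[q _]/(K i x) -uK hx raddf0.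
Qed.

(** Early entries of [c] are arbitrary, so representatives can be added and scaled pointwise in the
    whole product. *)
Definition represents (c : dprod A) (b : B) :=
  eventually (fun i => h i (c i) = b /\ c i.+1 = g i (c i)).

Lemma represents_push i (x : A i) : represents (push x) (h i x).
Proof. by exists i => j ij; rewrite limit_push ?pushS. Qed.

Lemma represents_ex b : exists c, represents c b.
Proof.
by have [i [x <-]] := limit_surj b; exists (push x); apply: represents_push.
Qed.

Lemma represents_lin r c d x y : represents c x -> represents d y ->
  represents (r *: c + d) (r *: x + y).
Proof.
move=> cx dy; apply: eventually_imp (eventually_and cx dy).
move=> i [[<- cS] [<- dS]].
have E j : (r *: c + d) j = r *: c j + d j by [].
by rewrite !E cS dS !linearP.
Qed.

Lemma represents0 : represents 0 0.
Proof. by exists 0 => i _; rewrite !raddf0. Qed.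

Lemma represents_sum n (r : 'I_n -> R) (c : 'I_n -> dprod A) (x : 'I_n -> B) :
  (forall j, represents (c j) (x j)) ->
  represents (\sum_j r j *: c j) (\sum_j r j *: x j).
Proof.
move=> cx; apply: (big_rec2 represents) => [|j b d _ db]; first exact: represents0.
exact: represents_lin.
Qed.

Lemma represents_eq0 c : represents c 0 -> eventually (fun i => c i = 0).
Proof.
move=> [k kc].
have [l lc] := limit_eq0 (kc k (leqnn k)).1.
exists (maxn k l) => i; rewrite geq_max => /andP[ki li].
by rewrite -(push_eq _ ki) ?lc // => j kj; rewrite (kc j kj).2.
Qed.

(** Choose representatives of the witnesses too. The left side of each equation then represents 0
    and so vanishes eventually; as there are finitely many equations, one stage serves them all. *)
Lemma pp_sat_limit n (phi : pp R n) (c : 'I_n -> dprod A) (x : 'I_n -> B) :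
  (forall j, represents (c j) (x j)) -> pp_sat phi x ->
  eventually (fun i => pp_sat phi (fun j => c j i)).
Proof.
move=> cx [y xy].
have /choice[d dy] : forall l, exists d, represents d (y l).
  by move=> l; apply: represents_ex.
pose eqn e : dprod A := \sum_j pp_free_coef phi e j *: c j +
  \sum_l pp_bound_coef phi e l *: d l.
have eqn0 : forall e, eventually (fun i => eqn e i = 0).
  move=> e; apply: represents_eq0; rewrite -(xy e) /eqn.
  have := represents_lin 1 (represents_sum (pp_free_coef phi e) cx)
                           (represents_sum (pp_bound_coef phi e) dy).
  by rewrite !scale1r.
apply: eventually_imp (eventually_forall eqn0) => i {}eqn0.
exists (fun l => d l i) => e; rewrite -[RHS](eqn0 e).
have sum_at m (F : 'I_m -> dprod A) : (\sum_j F j) i = \sum_j F j i.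
  by apply: (big_morph (fun f : dprod A => f i)).
have -> : eqn e i = (\sum_j pp_free_coef phi e j *: c j : dprod A) i +
  (\sum_l pp_bound_coef phi e l *: d l : dprod A) i by [].
by rewrite !sum_at.
Qed.

Lemma pp_sat_limit_lift n (phi : pp R n) (x : 'I_n -> B) :
  pp_sat phi x ->
  exists i (z : 'I_n -> A i), (forall j, h i (z j) = x j) /\ pp_sat phi z.
Proof.
move=> phix.
have /choice[c cx] : forall j, exists c, represents c (x j).
  by move=> l; apply: represents_ex.
have [k /(_ k (leqnn k))[phic ck]] :=
  eventually_and (pp_sat_limit cx phix) (eventually_forall cx).
by exists k, (fun j => c j k); split=> // j; case: (ck j).
Qed.

End DirectLimitTheory.

(** * Mittag-Leffler modules *)

Section MittagLeffler.
Variable R : pzRingType.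

(** A realization of [phi] in [N] gives images of the generators of [A] that obey its relations,
    hence a homomorphism carrying [a] to the realization. *)
Lemma fin_pres_mittag_leffler (A : lmodType R) : fin_pres A -> mittag_leffler A.
Proof.
move=> [m [k [K [f [f_surj f_ker]]]]] n a.
have /choice[s sK] := f_surj.
pose V := \matrix_(j < n) s (a j).
(* The formula says that x = V y for some y with K y = 0, where the rows of [V] express [a] in the
   generators. *)
pose phi : pp R n := PP (col_mx 1%:M 0) (col_mx (- V) K).
have phiE (N : lmodType R) (x : 'I_n -> N) : pp_sat phi x <->
    exists y : 'I_k -> N, (forall j, x j = \sum_l s (a j) 0 l *: y l) /\
      forall e, \sum_l K e l *: y l = 0.
  have E1 (y : 'I_k -> N) j :
      \sum_i pp_free_coef phi (lshift m j) i *: x i +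
      \sum_l pp_bound_coef phi (lshift m j) l *: y l =
      x j - \sum_l s (a j) 0 l *: y l.
    rewrite -[in RHS](sum_scalar_mx x) -sumrN; congr (_ + _); apply: eq_bigr => l _.
      by rewrite col_mxEu.
    by rewrite col_mxEu !mxE scaleNr.
  have E2 (y : 'I_k -> N) e :
      \sum_i pp_free_coef phi (rshift n e) i *: x i +
      \sum_l pp_bound_coef phi (rshift n e) l *: y l =
      \sum_l K e l *: y l.
    rewrite big1 ?add0r => [|i _]; last by rewrite col_mxEd mxE scale0r.
    by apply: eq_bigr => l _; rewrite col_mxEd.
  split=> [[y xy]|[y [xy Ky]]]; exists y.
    split=> [j|e]; last by rewrite -E2 xy.
    by apply/eqP; rewrite -subr_eq0 -E1 xy.
  move=> e; rewrite -(splitK e); case: (split e) => {}e; rewrite [unsplit _]/=.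
    by rewrite E1 xy subrr.
  by rewrite E2 Ky.
have f_sum v : f v = \sum_l v 0 l *: f (delta_mx 0 l).
  rewrite [in LHS](row_sum_delta v) raddf_sum; apply: eq_bigr => l _.
  exact: linearZ_LR.
exists phi.
  apply/phiE; exists (fun l => f (delta_mx 0 l)); split=> [j|e].
    by rewrite -f_sum sK.
  have -> : \sum_l K e l *: f (delta_mx 0 l) = f (row e K).
    by rewrite f_sum; apply: eq_bigr => l _; rewrite mxE.
  by apply/f_ker; exists (delta_mx 0 e); rewrite rowE.
move=> psi psia N x /phiE[y [xy Ky]].
pose w (v : 'rV[R]_k) := \sum_l v 0 l *: y l.
have w_lin : linear w.
  move=> r u v; rewrite /w scaler_sumr -big_split; apply: eq_bigr => l _.
  by rewrite !mxE scalerDl scalerA.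
have w_ker v : f v = 0 -> w v = 0.
  move=> /f_ker[c ->]; rewrite /w.
  under eq_bigr do rewrite mxE scaler_suml.
  rewrite exchange_big big1 //= => e _.
  under eq_bigr do rewrite -scalerA.
  by rewrite -scaler_sumr Ky scaler0.
pose W : {linear 'rV[R]_k -> N} :=
  HB.pack w (GRing.isLinear.Build R _ N *:%R w w_lin).
(* The section [s] of [f] is merely a function; [w \o s] is linear because [w] depends only on the
   value of [f]. *)
have w_eq u v : f u = f v -> w u = w v.
  move=> fuv; apply/eqP; rewrite -subr_eq0 -[w u]/(W u) -[w v]/(W v) -raddfB.
  by apply/eqP/w_ker; rewrite raddfB /= fuv subrr.
have t_lin : linear (w \o s).
  move=> r z z'; rewrite /= -w_lin; apply: w_eq.
  by rewrite linearP !sK.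
pose t : {linear A -> N} :=
  HB.pack (w \o s) (GRing.isLinear.Build R A N *:%R (w \o s) t_lin).
by apply: pp_sat_eq (pp_sat_lin t psia) => j; rewrite xy.
Qed.

(** Splitting one coordinate off [x], every pp formula true of [x] is true of both parts, so the sum
    of generators for the two parts generates the pp type of [x]. *)
Lemma dsum_mittag_leffler (I : Type) (C : I -> lmodType R) :
  (forall i, mittag_leffler (C i)) -> mittag_leffler (dsum C).
Proof.
move=> CML n; apply: dsum_tuple_ind => [|i x [phi phix phi_gen]].
  exists (pp_zero R n); first exact/pp_zeroE.
  move=> psi _ N y /pp_zeroE y0.
  by apply: pp_sat_eq (pp_sat0 psi N) => j; rewrite y0.
have [phi' phix' phi'_gen] := CML i n (fun j => dsum_proj i (x j)).
exists (pp_add phi phi') => [|psi psix N y /pp_addE[z yz z'y]].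
  apply/pp_addE; exists (fun j => dsum_in (dsum_proj i (x j))) => //.
  exact: (pp_sat_lin (@dsum_in _ _ C i)) phix'.
have psixi := pp_sat_lin (dsum_proj i) psix.
have psiz : pp_sat psi z by apply: phi'_gen z'y.
have psiyz : pp_sat psi (fun j => y j - z j).
  by apply: phi_gen yz; apply: pp_satB (pp_sat_lin (@dsum_in _ _ C i) psixi).
by apply: pp_sat_eq (pp_satD psiyz psiz) => j; rewrite subrK.
Qed.

(** [f] and [p] carry pp formulas both ways between [a] and [f \o a], so these tuples have the same
    pp type. *)
Lemma mittag_leffler_retract (M N : lmodType R) (f : {linear M -> N})
    (p : {linear N -> M}) : cancel f p -> mittag_leffler N -> mittag_leffler M.
Proof.
move=> fK NML n a; have [phi phia phi_gen] := NML n (f \o a).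
exists phi; last by move=> psi psia; apply: phi_gen; apply: pp_sat_lin.
by apply: pp_sat_eq (pp_sat_lin p phia) => j; rewrite /= fK.
Qed.

Lemma pure_projective_mittag_leffler (M : lmodType R) :
  pure_projective M -> mittag_leffler M.
Proof.
move=> [I [C [M' [f [Cfp [f' fK f'K]]]]]].
have f'_lin : linear f'.
  by move=> r x y; apply: (can_inj fK); rewrite linearP !f'K.
pose F' : {linear dsum C -> (M * M')%type} :=
  HB.pack f' (GRing.isLinear.Build R _ _ *:%R f' f'_lin).
have i_lin : linear (fun x : M => f (x, 0)).
  move=> r x y; rewrite -linearP; congr (f _); congr (_, _) => /=.
  by rewrite scaler0 addr0.
pose i : {linear M -> dsum C} :=
  HB.pack (fun x : M => f (x, 0)) (GRing.isLinear.Build R _ _ *:%R _ i_lin).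
have p_lin : linear (fst \o f') by move=> r x y; rewrite /= f'_lin.
pose p : {linear dsum C -> M} :=
  HB.pack (fst \o f') (GRing.isLinear.Build R _ _ *:%R _ p_lin).
apply: (@mittag_leffler_retract M (dsum C) i p) => [x|]; first by rewrite /= fK.
by apply: dsum_mittag_leffler => j; apply: fin_pres_mittag_leffler.
Qed.

End MittagLeffler.

(** * The modules F and F * B *)

Section SumOfSums.
Variables (R : pzRingType) (I J : Type) (C : I -> J -> lmodType R).

Local Notation D := (dsum (fun i => dsum (C i)) : lmodType R).
Local Notation E := (dsum (fun p : I * J => C p.1 p.2)).

Definition uncurry_fun (f : D) : dprod (fun p : I * J => C p.1 p.2) :=
  fun p => dsum_val (dsum_val f p.1) p.2.

Fact uncurry_finsupp f : uncurry_fun f \in finsupp (M := fun p => C p.1 p.2).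
Proof.
have [s sf] := dsum_supp f.
have /choice[t tf] := fun i : {classic I} => dsum_supp (dsum_val f i).
pose P i j : {classic I * J} := (i, j).
apply: (@in_finsupp _ _ _ (flatten [seq [seq P i j | j <- t i] | i <- s])).
move=> [i j] ijN; rewrite /uncurry_fun /=.
have [it|it] := boolP (j \in t i); last exact: tf.
rewrite [dsum_val f i]sf //; apply: contra ijN => si.
apply/(@flatten_mapP {classic I} {classic I * J}); exists i => //.
exact: (@map_f {classic J} {classic I * J} (P i)).
Qed.

Definition dsum_uncurry (f : D) : E := DSum (uncurry_finsupp f).

Fact curry_inner_finsupp (f : E) i :
  (fun j => dsum_val f (i, j)) \in finsupp (M := C i).
Proof.
have [s sf] := dsum_supp f; pose q (p : {classic I * J}) : {classic J} := p.2.
apply: (@in_finsupp _ _ _ [seq q p | p <- s]) => j js.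
by apply: sf; apply: contra js => /(map_f q).
Qed.

Fact curry_finsupp (f : E) :
  (fun i => DSum (curry_inner_finsupp f i)) \in finsupp (M := fun i => dsum (C i)).
Proof.
have [s sf] := dsum_supp f; pose q (p : {classic I * J}) : {classic I} := p.1.
apply: (@in_finsupp _ _ _ [seq q p | p <- s]) => i si.
by apply: dsum_ext => j; apply: sf; apply: contra si => /(map_f q).
Qed.

Definition dsum_curry (f : E) : D := DSum (curry_finsupp f).

Lemma dsum_uncurryK : cancel dsum_uncurry dsum_curry.
Proof. by move=> f; apply: dsum_ext => i; apply: dsum_ext. Qed.

Lemma dsum_curryK : cancel dsum_curry dsum_uncurry.
Proof. by move=> f; apply: dsum_ext => -[i j]. Qed.

(** The double sum is a single sum over [I * J]; the complementary summand is the zero module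
    ['rV[R]_0]. *)
Lemma dsum_dsum_pure_projective :
  (forall i j, fin_pres (C i j)) -> pure_projective D.
Proof.
move=> Cfp; pose F (x : D * 'rV[R]_0) := dsum_uncurry x.1.
have F_lin : linear F by move=> r x y; apply: dsum_ext => p.
pose f : {linear (D * 'rV[R]_0)%type -> E} :=
  HB.pack F (GRing.isLinear.Build R _ E *:%R F F_lin).
exists (I * J)%type, (fun p => C p.1 p.2), 'rV[R]_0, f.
split=> [p|]; first exact: Cfp.
exists (fun u => (dsum_curry u, 0)) => [[u v]|u] /=.
  by rewrite [v]thinmx0 /F dsum_uncurryK.
exact: dsum_curryK.
Qed.

End SumOfSums.

Section FreshModules.
Variables (R : pzRingType) (A : nat -> lmodType R).

Local Notation F := (dsum (fun i => dsum_omega (A i)) : lmodType R).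

(** The eventual form is the one that survives the induction: altering position [i] affects nothing
    beyond [i]. *)
Lemma dsum_omega_free_position (M : lmodType R) n (v : 'I_n -> dsum_omega M) :
  exists k, forall j, dsum_proj k (v j) = 0.
Proof.
suff [k /(_ k (leqnn k)) vk] :
    eventually (fun k => forall j, dsum_proj k (v j) = 0) by exists k.
move: v; apply: dsum_tuple_ind => [|i v [k vk]]; first by exists 0%N.
exists (maxn k i.+1) => l; rewrite geq_max => /andP[kl il] j.
have := vk l kl j; rewrite raddfB /= [X in _ - X]dprod_single_neq ?subr0 //.
by move=> eil; rewrite eil ltnn in il.
Qed.

(** For the summand condition, take a copy of [A i] at a position where the tuple has no
    component. *)
Lemma fresh_dsum_omega : fresh A F.
Proof.
split=> [n phi psi AP|i n v].
  by apply: pp_sub_dsum => i; apply: pp_sub_dsum => _; apply: AP.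
have [k vk] := dsum_omega_free_position (fun j => dsum_proj i (v j)).
exists (@dsum_in _ _ (fun i => dsum_omega (A i)) i \o @dsum_in _ _ (fun=> A i) k).
exists (@dsum_proj _ _ (fun=> A i) k \o @dsum_proj _ _ (fun i => dsum_omega (A i)) i).
split=> // x /=.
by rewrite dprod_single_id; apply: dsum_inK.
Qed.

(** Inclusions of pp formulas are checked on each factor; the fresh copies are taken inside [M]. *)
Lemma fresh_add (M B : lmodType R) :
  fresh A M -> pp_dominated A B -> fresh A (M * B)%type.
Proof.
move=> [Mdom Mfresh] Bdom.
have inl_lin : linear (fun x : M => (x, 0) : M * B).
  by move=> r x y; congr (_, _); rewrite /= scaler0 addr0.
have inr_lin : linear (fun x : B => (0, x) : M * B).
  by move=> r x y; congr (_, _); rewrite /= scaler0 addr0.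
pose inM : {linear M -> (M * B)%type} :=
  HB.pack (fun x : M => (x, 0) : M * B) (GRing.isLinear.Build R _ _ *:%R _ inl_lin).
pose inB : {linear B -> (M * B)%type} :=
  HB.pack (fun x : B => (0, x) : M * B) (GRing.isLinear.Build R _ _ *:%R _ inr_lin).
split=> [n phi psi AP x phix|i n v].
  have /(pp_sat_lin inM) M1 := Mdom _ _ _ AP _ (pp_sat_lin fst phix).
  have /(pp_sat_lin inB) B1 := Bdom _ _ _ AP _ (pp_sat_lin snd phix).
  apply: pp_sat_eq (pp_satD M1 B1) => j /=; case: (x j) => y z.
  by congr (_, _); rewrite /= ?addr0 ?add0r.
have [f [p [fK pv]]] := Mfresh i n (fst \o v).
by exists (inM \o f), (p \o fst).
Qed.

End FreshModules.

Theorem proposition20 (R : pzRingType) (n : nat) (phi : nat -> pp R n)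
  (phi_desc : descending phi)
  (A : nat -> lmodType R) (a : forall i, 'I_n -> A i)
  (Aa_free : forall i, free_realization (phi i) (a i))
  (g : forall i, {linear A i -> A i.+1})
  (ga : forall i j, g i (a i j) = a i.+1 j)
  (B : lmodType R) (h : forall i, {linear A i -> B})
  (B_lim : direct_limit g h) :
  let F : lmodType R := dsum (fun i => dsum_omega (A i)) in
  (pure_projective F /\ elem_equiv F (F * B)%type) /\
  (~ stabilizes phi -> ~ mittag_leffler B /\ ~ pure_projective B).
Proof.
move=> F; split.
  split.
    by apply: dsum_dsum_pure_projective => i _; case: (Aa_free i).
  have freshF : fresh A F := fresh_dsum_omega A.
  apply: fresh_elem_equiv freshF (fresh_add freshF _) => m theta psi sub x.
  move=> /(pp_sat_limit_lift B_lim)[i [z [zx /sub/(pp_sat_lin (h i)) psiz]]].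
  by apply: pp_sat_eq psiz => j; apply: zx.
move=> nstab; suff nML : ~ mittag_leffler B.
  by split=> // /pure_projective_mittag_leffler.
move=> BML; apply: nstab.
pose b j := h 0%N (a 0%N j).
have ab i j : h i (a i j) = b j.
  by elim: i => // i <-; rewrite -ga B_lim.1.
have [theta thetab theta_gen] := BML n b.
have arep j : represents g h (fun i => a i j) (b j).
  by exists 0%N => i _; rewrite ab ga.
have [i /(_ i (leqnn i)) thetaa] := pp_sat_limit B_lim arep thetab.
exists i => j _ N x phix.
(* Freeness moves [a i], together with [theta], onto [x]. *)
have [_ _ /(_ N x phix)[u ua]] := Aa_free i.
suff theta_phi : pp_le theta (phi j).
  apply: theta_phi; apply: pp_sat_eq (pp_sat_lin u thetaa) => l.
  exact: ua.
apply: theta_gen; have [_ phia _] := Aa_free j.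
by apply: pp_sat_eq (pp_sat_lin (h j) phia) => l; apply: ab.
Qed.
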